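(* The symmetric group $S_5$ is a $B$-group.
   Context: For a finite group $G$ and $N\unlhd G$, set $$m_{G,N}:=\frac{1}{|G|}\sum_{X\leq G,\ XN=G}|X|\,\mu(X,G),$$ where $\mu$ is the Möbius function of the poset of subgroups of $G$ ordered by inclusion. A finite group $G$ is called a $B$-group if $m_{G,N}=0$ for every non-trivial normal subgroup $N$ of $G$. *)

(* Defs.v *)
From HB Require Import structures.
From mathcomp Require Import all_boot all_order all_algebra all_fingroup.

Set Implicit Arguments.
Unset Strict Implicit.
Unset Printing Implicit Defensive.

Import Order.TTheory GRing.Theory.
Local Open Scope ring_scope.

Section Mobius.
Context {d : Order.disp_t} {T : finPOrderType d}.
Implicit Types x y z : T.

(* [n] only ensures termination: a chain in [T] has at most [#|T|] elements,
   so the value is independent of [n] for [n >= #|T|]; see [mobius_lt]. *)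
Fixpoint mobius_rec (n : nat) (x y : T) : int :=
  if n is n'.+1 then
    if x == y then 1
    else if (x < y)%O then - \sum_(z : T | (x <= z < y)%O) mobius_rec n' x z
    else 0
  else 0.

Definition mobius (x y : T) : int := mobius_rec #|T| x y.

Lemma mobius_rec_stable n m x y :
  (#|[pred z | z < y]%O| < n)%N -> (#|[pred z | z < y]%O| < m)%N ->
  mobius_rec n x y = mobius_rec m x y.
Proof.
elim: n m y => [|n IHn] [|m] y //= lt_n lt_m.
case: eqP => // _; case: ifP => // _; congr (- _).
apply: eq_bigr => z /andP[_ lt_zy].
have lt_down : (#|[pred t | t < z]%O| < #|[pred t | t < y]%O|)%N.
  apply: proper_card; apply/properP; split.
    by apply/subsetP => t; rewrite !inE => /lt_trans; apply.
  by exists z; rewrite !inE ?ltxx.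
by apply: IHn; exact: leq_trans lt_down _.
Qed.

Lemma card_down_lt y : (#|[pred z | z < y]%O| < #|T|)%N.
Proof.
apply: proper_card; apply/properP; split; first exact: subset_predT.
by exists y; rewrite !inE ?ltxx.
Qed.

Lemma mobius_refl x : mobius x x = 1.
Proof.
rewrite /mobius; have := card_down_lt x; case: #|T| => //= n _.
by rewrite eqxx.
Qed.

Lemma mobius_lt x y :
  (x < y)%O -> mobius x y = - \sum_(z : T | (x <= z < y)%O) mobius x z.
Proof.
move=> lt_xy; rewrite /mobius.
rewrite (@mobius_rec_stable #|T| #|T|.+1) ?card_down_lt //=;
  last exact: ltnW (card_down_lt y).
by rewrite lt_eqF // lt_xy.
Qed.

Lemma mobius_nle x y : ~~ (x <= y)%O -> mobius x y = 0.
Proof.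
move=> nle_xy; rewrite /mobius; case: #|T| => //= n.
by case: eqP nle_xy => [->|_]; rewrite ?lexx // le_eqVlt negb_or => /andP[_ /negPf->].
Qed.

End Mobius.

Definition subgroup_poset (gT : finGroupType) := {group gT}.

Fact subgroup_display : Order.disp_t. Proof. exact: (Order.Disp tt tt). Qed.

HB.instance Definition _ (gT : finGroupType) :=
  Finite.on (subgroup_poset gT).

Section SubgroupPoset.
Context (gT : finGroupType).

Definition subgroup_le (X Y : subgroup_poset gT) : bool :=
  (X : {group gT}) \subset (Y : {group gT}).

Fact subgroup_le_refl : reflexive subgroup_le.
Proof. by move=> X; exact: subxx. Qed.

Fact subgroup_le_anti : antisymmetric subgroup_le.
Proof. by move=> X Y sXY; apply/val_inj/eqP; rewrite eqEsubset. Qed.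

Fact subgroup_le_trans : transitive subgroup_le.
Proof. by move=> Y X Z; exact: subset_trans. Qed.

HB.instance Definition _ :=
  Order.Le_isPOrder.Build subgroup_display (subgroup_poset gT)
    subgroup_le_refl subgroup_le_anti subgroup_le_trans.

End SubgroupPoset.

(* The poset contains all subgroups of the ambient type; this does not affect
   [mobius X G], which only involves the interval between [X] and [G]. *)
Definition mGN (gT : finGroupType) (G N : {group gT}) : rat :=
  (#|G|%:R)^-1 *
  \sum_(X : {group gT} | (X \subset G) && ((X * N)%g == G :> {set gT}))
     #|X|%:R * (mobius (X : subgroup_poset gT) (G : subgroup_poset gT))%:~R.

Definition B_group (gT : finGroupType) (G : {group gT}) : Prop :=
  forall N : {group gT}, (N <| G)%g -> (N :!=: 1)%g -> mGN G N = 0.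

(* Main.v *)
(** Every proper quotient of [S_5] is cyclic, while [S_5] is not, and
    [mGN G N = 0] whenever [G / N] is cyclic and [G] is not: let [N :* g]
    generate [G / N].  If [X <= G] contains some [x] in [N :* g] then
    [X N = G], so the sum of [mu(X, G)] over the [X <= G] containing [x] is a full
    interval sum from [<[x]> < G], and vanishes.  Summing over [x] weights
    [mu(X, G)] by [#|X :&: N :* g| = #|X| #|N| / #|G|]. *)

Require Import Defs.
From mathcomp Require Import all_boot all_order all_algebra all_fingroup.
From mathcomp Require Import all_solvable.

Set Implicit Arguments.
Unset Strict Implicit.
Unset Printing Implicit Defensive.

Import Order.TTheory GRing.Theory.
Local Open Scope ring_scope.

(* The recursion defining [mobius] sums over the second argument; the sum over
   the first argument comes from left inverse matrices being right inverses. *)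
Lemma mobius_sum_interval (d : Order.disp_t) (T : finPOrderType d) (x y : T) :
  (x < y)%O -> \sum_(z : T | (x <= z <= y)%O) mobius z y = 0.
Proof.
move=> lt_xy.
pose M := \matrix_(i < #|T|, j < #|T|) mobius (enum_val i) (enum_val j).
pose Z := \matrix_(i < #|T|, j < #|T|) ((enum_val i <= enum_val j)%O%:R : int).
have sum_enum (F : T -> int) : \sum_(k < #|T|) F (enum_val k) = \sum_z F z.
  by rewrite -(big_enum_val F).
(* [Z] is the zeta matrix of the order. The entry of [M *m Z] at [(a, b)] sums [mobius a z] over
   [a <= z <= b]; for [a < b], the recursion makes the term [z = b] cancel the others. *)
have MZ : M *m Z = 1%:M.
  apply/matrixP=> i j; rewrite !mxE -(inj_eq enum_val_inj).
  under eq_bigr do rewrite !mxE.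
  move: (enum_val i) (enum_val j) => a b.
  rewrite (sum_enum (fun z => mobius a z * (z <= b)%O%:R)).
  rewrite (bigID (fun z => (a <= z <= b)%O)) /= [X in _ + X]big1 => [|z]; last first.
    by rewrite negb_and => /orP[/mobius_nle->|/negPf->]; rewrite ?mul0r ?mulr0.
  rewrite addr0 (eq_bigr (mobius a)) => [|z /andP[_ ->]]; last by rewrite mulr1.
  have [<-|neq_ab] := eqVneq a b.
    rewrite (big_pred1 a) ?mobius_refl // => z.
    by rewrite andbC -eq_le.
  have [le_ab|nle_ab] := boolP (a <= b)%O; last first.
    rewrite big1 // => z /andP[le_az le_zb].
    by rewrite (le_trans le_az le_zb) in nle_ab.
  have lt_ab : (a < b)%O by rewrite lt_neqAle neq_ab.
  rewrite (bigD1 b) ?le_ab ?lexx //= mobius_lt // addrC.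
  apply/eqP; rewrite subr_eq0; apply/eqP/eq_bigl => z.
  by rewrite [(z < b)%O]lt_neqAle -andbA; congr (_ && _); rewrite andbC.
have /matrixP/(_ (enum_rank x) (enum_rank y)) := mulmx1C MZ.
rewrite !mxE (inj_eq enum_rank_inj) lt_eqF // mulr0n => ZMxy; rewrite -[RHS]ZMxy.
under [RHS]eq_bigr do rewrite !mxE !enum_rankK.
rewrite (sum_enum (fun z => (x <= z)%O%:R * mobius z y)) big_mkcond.
apply: eq_bigr => z _; case: (x <= z)%O; rewrite ?mul0r ?mul1r //=.
by case: ifP => // /negbT/mobius_nle->.
Qed.

Local Open Scope group_scope.

(** Writing [g = n * x] with [n] in [N] and [x] in [X] shows that [X] meets [N :* g] in a coset of
    [X :&: N]; the product formula for [#|X * N|] does the rest. *)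
Lemma card_setI_rcoset (gT : finGroupType) (G N X : {group gT}) (g : gT) :
  X * N = G -> N <| G -> g \in G -> (#|X :&: N :* g| * #|G| = #|X| * #|N|)%N.
Proof.
move=> defG nsNG; have nNX : X \subset 'N(N).
  by rewrite (subset_trans _ (normal_norm nsNG)) // -defG mulG_subl.
rewrite -defG normC // => /mulsgP[n x Nn Xx ->].
have -> : X :&: N :* (n * x) = (X :&: N) :* x.
  rewrite rcosetM rcoset_id // -{1}(rcoset_id Xx).
  by apply/setP=> y; rewrite !(inE, mem_rcoset).
by rewrite card_rcoset mulnC -normC // mul_cardG.
Qed.

Lemma mGN_cyclic_quotient (gT : finGroupType) (G N : {group gT}) :
  N <| G -> cyclic (G / N) -> ~~ cyclic G -> mGN G N = 0%R.
Proof.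
move=> nsNG /cyclicP[gN defGN] ncycG.
have [sNG nNG] := andP nsNG.
have : gN \in G / N by rewrite defGN cycle_id.
case/morphimP=> g nNg Gg def_gN.
(* Such an [x] maps to the generator [gN], so the image of [X] is all of [G / N]. *)
have mulXN (X : {group gT}) x :
    X \subset G -> x \in X -> x \in N :* g -> X * N == G.
  move=> sXG Xx Ngx; have nNX := subset_trans sXG nNG.
  rewrite eqEsubset mul_subG //= normC // -quotientSK // defGN cycle_subG.
  rewrite def_gN /= -(_ : coset N x = coset N g) ?mem_quotient //.
  by apply/rcoset_kercosetP => //; apply: (subsetP nNX).
apply/eqP; rewrite /mGN mulf_eq0; apply/orP; right.
(* The factor [#|N|] turns each weight [#|X|] into [#|G|] times the number of [x] in [X :&: N :* g],
   so that the two sums can be exchanged. *)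
have /mulfI/inj_eq<- : (#|N|%:R : rat) != 0%R by rewrite Num.Theory.pnatr_eq0 -lt0n.
rewrite mulr0 big_distrr /=; apply/eqP.
pose mu (X : {group gT}) : rat :=
  (mobius (X : subgroup_poset gT) (G : subgroup_poset gT))%:~R.
transitivity (\sum_(X : {group gT} | (X \subset G) && ((X * N)%g == G))
                \sum_(x in N :* g | x \in X) #|G|%:R * mu X)%R.
  apply: eq_bigr => X /andP[_ /eqP defG].
  rewrite sumr_const mulrA -natrM mulnC -(card_setI_rcoset defG nsNG Gg).
  rewrite natrM -mulrA mulr_natl; congr (_ *+ _)%R.
  by apply: eq_card => x; rewrite !inE andbC.
rewrite (exchange_big_dep (fun x => x \in N :* g)) /=; last by move=> X x _ /andP[].
apply: big1 => x Ngx; rewrite -big_distrr /= Ngx.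
have Gx : x \in G by apply: subsetP Ngx; rewrite mul_subG ?sub1set.
have lt_xG : ((<[x]>%G : subgroup_poset gT) < (G : subgroup_poset gT))%O.
  rewrite lt_neqAle; apply/andP; split; last by rewrite /Order.le /= /subgroup_le cycle_subG.
  by apply: contraNneq ncycG => <-; exact: cycle_cyclic.
have sum_mu0 : (\sum_(X : subgroup_poset gT |
    (<[x]>%G : subgroup_poset gT) <= X <= (G : subgroup_poset gT)) mu X = 0)%O%R.
  by rewrite -(rmorph_sum intr) mobius_sum_interval.
rewrite (_ : (\sum_(X | _) mu X)%R = 0%R) ?mulr0 // -[RHS]sum_mu0.
(* By [mulXN], the condition [X * N = G] is automatic once [x] lies in [X]. *)
apply: eq_bigl => X.
rewrite /Order.le /= /subgroup_le cycle_subG andbC.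
have [Xx|] := boolP (x \in X); rewrite ?andbF //=.
have [sXG|] := boolP (X \subset G); rewrite //= (mulXN X x) //.
Qed.

(** If [s] moves [i], take [k] outside [i] and [s i]: the transposition of [s i] and [k] fixes [i]
    but moves [s i], so it cannot commute with [s]. *)
Lemma commute_tperm_eq1 (T : finType) (s : {perm T}) :
  (2 < #|T|)%N -> (forall x y, commute s (tperm x y)) -> s = 1.
Proof.
move=> T_gt2 cs; apply/permP=> i; rewrite perm1; apply/eqP/idPn=> si_i.
have /card_gt0P[k] : (0 < #|~: [set i; s i]|)%N.
  rewrite -(ltn_add2l #|[set i; s i]|) cardsC addn0.
  by apply: leq_ltn_trans T_gt2; rewrite cards2; case: (_ != _).
rewrite !inE negb_or => /andP[ki ksi].
have := congr1 (fun t : {perm T} => t i) (cs (s i) k).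
by rewrite !permM tpermL tpermD // => eq_k; rewrite eq_k eqxx in ksi.
Qed.

(** By simplicity, [N] contains ['Alt_T] or meets it trivially. In the second case, the commutator
    of [s] in [N] with a transposition is even and lies in [N], hence is trivial; so [s] commutes
    with all transpositions and is 1. *)
Lemma normal_Sym_sup_Alt (T : finType) (N : {group {perm T}}) :
  (4 < #|T|)%N -> N <| 'Sym_T -> N :!=: 1 -> 'Alt_T \subset N.
Proof.
move=> T_gt4 nsN ntN.
have /simpleP[_ simAlt] := simple_Alt5 T_gt4.
have nsNA : N :&: 'Alt_T <| 'Alt_T.
  by rewrite setIC (normalGI (Alt_subset T)).
have [NA1|<-] := simAlt (N :&: 'Alt_T)%G nsNA; last exact: subsetIl.
case/negP: ntN; apply/eqP/trivgP/subsetP => s Ns; rewrite inE; apply/eqP.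
apply: commute_tperm_eq1 => [|x y]; first exact: ltn_trans T_gt4.
apply/commgP; rewrite -in_set1 -[[set 1]]NA1 inE Alt_even commgEl; apply/andP; split.
  by rewrite groupM ?groupV // memJ_norm // (subsetP (normal_norm nsN)) ?inE.
by rewrite odd_permM odd_permV odd_permJ addbb.
Qed.

Theorem proposition1p4 : B_group [set: 'S_5]%G.
Proof.
move=> N nsN ntN; apply: mGN_cyclic_quotient => //.
  have sAN : 'Alt_('I_5) \subset N by apply: normal_Sym_sup_Alt; rewrite ?card_ord.
  (* The index of [N] divides that of the alternating group. *)
  have : (#|[set: 'S_5] / N| %| 2)%N.
    rewrite card_quotient ?normal_norm //.
    by rewrite -[2%N in X in (_ %| X)%N](@Alt_index 'I_5) ?card_ord ?indexgS.
  rewrite dvdn_divisors // !inE => /orP[/eqP/card1_trivg->|/eqP cardSN].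
    exact: cyclic1.
  by rewrite prime_cyclic ?cardSN.
(* In an abelian ['S_5], a transposition would be central, hence trivial. *)
apply/negP=> /cyclic_abelian abS.
have /permP/(_ ord0) : tperm ord0 ord_max = 1 :> 'S_5.
  apply: commute_tperm_eq1 => [|x y]; first by rewrite card_ord.
  by apply: (centsP abS); rewrite inE.
by rewrite tpermL perm1.
Qed.
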